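(* Let $G$ be a locally nilpotent soluble group. Then $G$ lies in the class $\mathcal S$ if and only if $G$ is either nilpotent or minimal non-nilpotent.
   Context: $\mathcal S$ denotes the class of all groups $G$ such that every non-nilpotent subgroup $H \le G$ satisfies $N_G(H) = H$. A group is minimal non-nilpotent if it is not nilpotent but every proper subgroup of it is nilpotent. Groups may be infinite. *)

(* Defs.v *)
From HB Require Import structures.
From mathcomp Require Import all_boot.
From mathcomp Require Import all_classical.

Set Implicit Arguments.
Unset Strict Implicit.
Unset Printing Implicit Defensive.

Local Open Scope group_scope.
Local Open Scope classical_set_scope.

(* Groups are MathComp's [groupType]s, which need not be finite. A subgroup is  *)
(* a classical subset closed under the operations; a property of a group that  *)
(* is also needed for its subgroups is stated for subsets of an ambient group, *)
(* and the group itself is then the subset [set: G].                           *)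

Definition is_subgroup (G : groupType) (H : set G) : Prop :=
  [/\ H 1,
      forall x y, H x -> H y -> H (x * y)
    & forall x, H x -> H x^-1].

Definition generated (G : groupType) (A : set G) : set G :=
  smallest (@is_subgroup G) A.

Definition commutator (G : groupType) (H K : set G) : set G :=
  generated [set [~ x, y] | x in H & y in K].

Definition normalizer (G : groupType) (H : set G) : set G :=
  [set g | [set x ^ g | x in H] = H].

Fixpoint lower_central (G : groupType) (H : set G) (n : nat) : set G :=
  if n is m.+1 then commutator (lower_central H m) H else H.

Fixpoint derived_series (G : groupType) (H : set G) (n : nat) : set G :=
  if n is m.+1 then commutator (derived_series H m) (derived_series H m) else H.

Definition nilpotent (G : groupType) (H : set G) : Prop :=
  exists n, lower_central H n = [set 1].

Definition soluble (G : groupType) (H : set G) : Prop :=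
  exists n, derived_series H n = [set 1].

Definition locally_nilpotent (G : groupType) : Prop :=
  forall A : set G, finite_set A -> nilpotent (generated A).

Definition minimal_non_nilpotent (G : groupType) : Prop :=
  ~ nilpotent [set: G] /\
  forall H : set G, is_subgroup H -> H <> [set: G] -> nilpotent H.

Definition class_S (G : groupType) : Prop :=
  forall H : set G, is_subgroup H -> ~ nilpotent H -> normalizer H = H.

(* Main.v *)
(* In a locally nilpotent group a subgroup [K] that is maximal among those     *)
(* avoiding an element [a] is normalised by [a].  Otherwise, up to replacing   *)
(* [a] by its inverse, [x = [k, a]] lies outside [K] for some [k] in [K], so   *)
(* [a] lies in [<F, x>] for a finite subset [F] of [K].  Let [L] be the        *)
(* nilpotent group [<F, k, a>], with lower central series [L_0 = L, L_1, ...]. *)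
(* If [a] lies in [(K /\ L) L_n], then [x], and with it [a], lies in           *)
(* [(K /\ L) L_(n+1)]; hence [a] lies in [K], a contradiction.                 *)
(* Given a proper non-nilpotent subgroup [H] and [a] outside [H], Zorn's lemma *)
(* provides such a [K] containing [H]; it is non-nilpotent and is not its own  *)
(* normaliser, so the group is not in the class S.                             *)
Require Import Defs.
From mathcomp Require Import all_boot.
From mathcomp Require Import all_classical.

Local Open Scope classical_set_scope.

Section Subgroups.
Local Open Scope group_scope.
Set Implicit Arguments.
Unset Strict Implicit.
Variable G : groupType.
Implicit Types (A B F H K L : set G) (a g h k x y z : G).

Lemma conjg_mulR x y : x ^ y = x * [~ x, y].
Proof. by rewrite mulVKg. Qed.

Lemma commgMJ x y z : [~ x, y * z] = [~ x, z] * [~ x, y] ^ z.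
Proof. by rewrite !commgEl !conjgE invgM !mulgA !mulgK. Qed.

Lemma generated_subgroup A : is_subgroup (generated A).
Proof.
split=> [B AB|x y Ax Ay B AB|x Ax B AB].
- by have [] := AB.1.
- by have [_ M _] := AB.1; apply: M (Ax _ AB) (Ay _ AB).
- by have [_ _ V] := AB.1; apply: V (Ax _ AB).
Qed.

Lemma sub_generated A : A `<=` generated A.
Proof. exact: sub_gen_smallest. Qed.

Lemma generated_sub A H : is_subgroup H -> A `<=` H -> generated A `<=` H.
Proof. by move=> gH AH x; apply. Qed.

Lemma generatedS A B : A `<=` B -> generated A `<=` generated B.
Proof.
move=> AB; apply: generated_sub (generated_subgroup B) _.
exact: subset_trans (@sub_generated B).
Qed.

(** The elements reached from finite subsets of [A] already form a subgroup containing [A]: a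
    product needs only the union of two finite sets. This is how local nilpotency is brought to
    bear. *)
Lemma generated_finite A x : generated A x ->
  exists F, [/\ finite_set F, F `<=` A & generated F x].
Proof.
move: x; apply: generated_sub; last first.
  move=> x Ax; exists [set x]; split; first exact: finite_set1.
    by move=> _ ->.
  exact: sub_generated.
split.
- exists set0; split; [exact: finite_set0 | exact: sub0set |].
  by have [] := generated_subgroup set0.
- move=> x y [F [finF FA Fx]] [E [finE EA Ey]]; exists (F `|` E); split.
  + by rewrite finite_setU.
  + by rewrite subUset.
  + have [_ M _] := generated_subgroup (F `|` E).
    apply: M; first exact: generatedS (@subsetUl _ F E) _ Fx.
    exact: generatedS (@subsetUr _ F E) _ Ey.
- move=> x [F [finF FA Fx]]; exists F; split=> //.
  by have [_ _ V] := generated_subgroup F; apply: V.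
Qed.

Lemma subgroup_conj H x g : is_subgroup H -> H x -> H g -> H (x ^ g).
Proof. by case=> _ M V Hx Hg; rewrite conjgE; apply: M (V _ Hg) (M _ _ Hx Hg). Qed.

Lemma subgroup_comm H x y : is_subgroup H -> H x -> H y -> H [~ x, y].
Proof.
by move=> gH Hx Hy; have [_ M V] := gH; apply: M (V _ Hx) (subgroup_conj _ _ _).
Qed.

Lemma mem_commutator H K x y : H x -> K y -> commutator H K [~ x, y].
Proof. by move=> Hx Ky; apply: sub_generated; exists x => //; exists y. Qed.

Lemma commutatorS H1 H2 K1 K2 : H1 `<=` H2 -> K1 `<=` K2 ->
  commutator H1 K1 `<=` commutator H2 K2.
Proof.
move=> sH sK; apply: generatedS => _ [x H1x [y K1y <-]].
by exists x; first exact: sH; exists y; first exact: sK.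
Qed.

Lemma lower_centralS H K n : H `<=` K -> lower_central H n `<=` lower_central K n.
Proof. by move=> sHK; elim: n => //= n IHn; apply: commutatorS. Qed.

Lemma nilpotentS H K : is_subgroup H -> H `<=` K -> nilpotent K -> nilpotent H.
Proof.
move=> gH sHK [n K1]; exists n; apply/seteqP; split.
  by rewrite -K1; apply: lower_centralS.
move=> _ ->; case: n {K1} => [|n]; first by case: gH.
by have [] := generated_subgroup
  [set [~ x, y] | x in lower_central H n & y in H].
Qed.

Section LowerCentral.
Variables (L : set G) (gL : is_subgroup L).

Lemma lower_central_subgroup n : is_subgroup (lower_central L n).
Proof. by case: n => [//|n]; apply: generated_subgroup. Qed.

Lemma lower_central_decr n : lower_central L n.+1 `<=` lower_central L n.
Proof.
elim: n => [|n IHn]; last exact: commutatorS.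
by apply: generated_sub => // _ [x Lx [y Ly <-]]; apply: subgroup_comm.
Qed.

(** Each term is normal in [L], since z^g = z [z, g] and [z, g] lies in the next, smaller term. *)
Lemma lower_central_conj n z g :
  lower_central L n z -> L g -> lower_central L n (z ^ g).
Proof.
move=> Zz Lg; have [_ M _] := lower_central_subgroup n.
rewrite conjg_mulR; apply: M => //; apply: lower_central_decr.
exact: mem_commutator.
Qed.

Lemma lower_central_comml n z g :
  lower_central L n z -> L g -> lower_central L n.+1 [~ g, z].
Proof.
move=> Zz Lg; have [_ _ V] := lower_central_subgroup n.+1.
by rewrite -invgR; apply: V; apply: mem_commutator.
Qed.

(** The product (H /\ L) L_n. The left factor is kept in [L] so that it normalises L_n, which makes
    the product a subgroup. *)
Definition mul_lower_central H n : set G :=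
  [set y | exists h z, [/\ H h, L h, lower_central L n z & y = h * z]].

Lemma mul_lower_central_subgroup H n :
  is_subgroup H -> is_subgroup (mul_lower_central H n).
Proof.
case=> H1 HM HV; have [L1 LM LV] := gL.
have [Z1 ZM ZV] := lower_central_subgroup n; split.
- by exists 1, 1; rewrite mulg1.
- move=> _ _ [h1 [z1 [Hh1 Lh1 Zz1 ->]]] [h2 [z2 [Hh2 Lh2 Zz2 ->]]].
  exists (h1 * h2), (z1 ^ h2 * z2); split; [exact: HM|exact: LM| |].
    by apply: ZM => //; apply: lower_central_conj.
  by rewrite conjgE !mulgA mulgK.
- move=> _ [h [z [Hh Lh Zz ->]]].
  exists h^-1, (z^-1 ^ h^-1); split; [exact: HV|exact: LV| |].
    by apply: lower_central_conj; [apply: ZV | apply: LV].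
  by rewrite conjgE invgK invgM !mulgA mulVg mul1g.
Qed.

(** L_n is central in L modulo L_(n+1), so for a = h z the commutator [k, a] agrees with [k, h]
    modulo L_(n+1). *)
Lemma comm_mul_lower_central H n k a : is_subgroup H -> H k -> L k ->
  mul_lower_central H n a -> mul_lower_central H n.+1 [~ k, a].
Proof.
move=> gH Hk Lk [h [z [Hh Lh Zz ->]]].
have Hc : H [~ k, h] by apply: subgroup_comm.
have Lc : L [~ k, h] by apply: subgroup_comm.
have [_ ZM _] := lower_central_subgroup n.+1.
(* Expand [k, h z] = [k, z] [k, h] [[k, h], z] and move [k, h] to the front. *)
exists [~ k, h], ([~ k, z] ^ [~ k, h] * [~ [~ k, h], z]); split=> //.
  apply: ZM; last exact: lower_central_comml.
  by apply: lower_central_conj => //; apply: lower_central_comml.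
by rewrite commgMJ (conjg_mulR [~ k, h]) [RHS]mulgA -conjgC -[RHS]mulgA.
Qed.

End LowerCentral.

Lemma maximal_avoiding H a : is_subgroup H -> ~ H a ->
  exists K, [/\ is_subgroup K, H `<=` K, ~ K a
    & forall y, ~ K y -> generated (K `|` [set y]) a].
Proof.
move=> gH nHa.
(* Adjoining [H] makes the empty union an admissible upper bound. *)
pose P := [set X : set G | is_subgroup (H `|` X) /\ ~ (H `|` X) a].
have [|X [[gX nXa] maxX]] := @Zorn_bigcup _ P.
  move=> C CP totC; split; last first.
    by case=> // -[X CX Xa]; have [_] := CP _ CX; apply; right.
  have [H1 HM HV] := gH.
  have incl X : C X -> H `|` X `<=` H `|` \bigcup_(Y in C) Y.
    by move=> CX; apply: setUS; apply: bigcup_sup.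
  split; first by left.
  - move=> x y [Hx|[X CX Xx]] [Hy|[Y CY Yy]]; first by left; apply: HM.
    + have [[_ M _] _] := CP _ CY.
      by apply: (incl _ CY); apply: M; [left | right].
    + have [[_ M _] _] := CP _ CX.
      by apply: (incl _ CX); apply: M; [right | left].
    + have [sXY|sYX] := totC _ _ CX CY.
        have [[_ M _] _] := CP _ CY.
        by apply: (incl _ CY); apply: M; right => //; apply: sXY.
      have [[_ M _] _] := CP _ CX.
      by apply: (incl _ CX); apply: M; right => //; apply: sYX.
  - move=> x [Hx|[X CX Xx]]; first by left; apply: HV.
    by have [[_ _ V] _] := CP _ CX; apply: (incl _ CX); apply: V; right.
exists (H `|` X); split=> // y nXy.
(* If [B] avoided [a], it would be a member of [P] strictly above [X], because it contains [y]. *)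
apply: contrapT => nBa; set B := generated _ in nBa.
have sB : H `|` X `|` [set y] `<=` B by apply: sub_generated.
have HB : H `|` B = B by apply/setUidPr => h Hh; apply: sB; left; left.
apply: (maxX B); last by split; rewrite HB //; apply: generated_subgroup.
split; first by move=> x Xx; apply: sB; left; right.
by move=> sBX; apply: nXy; right; apply: sBX; apply: sB; right.
Qed.

Lemma maximal_avoiding_conj K a k : locally_nilpotent G -> is_subgroup K ->
  ~ K a -> (forall y, ~ K y -> generated (K `|` [set y]) a) ->
  K k -> K (k ^ a).
Proof.
move=> nilG gK nKa maxK Kk; apply: contrapT => nKka.
have [_ KM _] := gK.
have nKx : ~ K [~ k, a] by move=> Kx; apply: nKka; rewrite conjg_mulR; apply: KM.
have [F [finF sF Fa]] := generated_finite (maxK _ nKx).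
pose L := generated (F `|` [set k; a]).
have gL : is_subgroup L by apply: generated_subgroup.
have [FL Lk La] : [/\ F `<=` L, L k & L a].
  split; first exact: subset_trans (@subsetUl _ _ _) (@sub_generated _).
    by apply: sub_generated; right; left.
  by apply: sub_generated; right; right.
have [n Ln1] : nilpotent L.
  by apply: nilG; rewrite finite_setU; split=> //; apply: finite_set2.
(* Induction down the series from L_0 = L: each element of [F] lies in [K] or equals [k, a], and the
   hypothesis on [a] places [k, a] one term deeper. Since [F] generates [a], so does [a] descend. *)
have : mul_lower_central L K n a.
  elim: n {Ln1} => [|n IHn].
    by exists 1, a; rewrite mul1g; split=> //; [case: gK | case: gL].
  have gP := mul_lower_central_subgroup gL n.+1 gK.
  apply: (generated_sub gP) Fa => f Ff.
  have [Kf|fx] := sF _ Ff; last by rewrite fx; apply: comm_mul_lower_central.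
  have [Z1 _ _] := lower_central_subgroup gL n.+1.
  by exists f, 1; rewrite mulg1; split=> //; apply: FL.
by case=> h [z []]; rewrite Ln1 => Kh _ -> ah; apply: nKa; rewrite ah mulg1.
Qed.

End Subgroups.

Theorem theorem3p6 (G : groupType)
  (G_locally_nilpotent : locally_nilpotent G)
  (G_soluble : soluble [set: G]) :
  class_S G <-> nilpotent [set: G] \/ minimal_non_nilpotent G.
Proof.
split=> [SG|[nilG H gH nnH|[nnG minG] H gH nnH]]; last 2 first.
(* A nilpotent group has no non-nilpotent subgroup; in a minimal non-nilpotent group the only one is
   the whole group, which is its own normaliser. *)
- by case: nnH; apply: nilpotentS nilG.
- have -> : H = [set: G] by apply: contrapT => /(minG H gH).
  apply/seteqP; split=> // g _; apply/seteqP; split=> // x _.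
  by exists (x ^ g^-1)%g; rewrite ?conjgKV.
have [nilG|nnG] := pselect (nilpotent [set: G]); [by left | right].
split=> // H gH HG; apply: contrapT => nnH.
have [a nHa] : exists a, ~ H a.
  by apply/existsNP => allH; apply: HG; apply/seteqP; split.
have [K [gK HK nKa maxK]] := maximal_avoiding gH nHa.
have nnK : ~ nilpotent K by move=> nilK; apply/nnH/(nilpotentS gH HK).
(* As [K] is its own normaliser, it suffices that [a] normalises [K]. *)
apply: (nKa); rewrite -(SG K gK nnK).
have [_ _ KV] := gK.
apply/seteqP; split=> [_ [x Kx <-]|x Kx].
  exact: maximal_avoiding_conj maxK Kx.
(* The reverse inclusion is the same lemma for a^-1: a subgroup contains [a] exactly when it
   contains a^-1, so [K] is also maximal avoiding a^-1. *)
exists (x ^ a^-1)%g; last by rewrite conjgKV.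
apply: maximal_avoiding_conj Kx => // [/KV|y /maxK].
  by rewrite invgK.
by have [_ _ V] := generated_subgroup (K `|` [set y]); apply: V.
Qed.
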